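(* If $\mathbb{C}$ is a category with finite limits and binary coproducts, and both $\mathbb{C}$ and its dual $\mathbb{C}^{\mathrm{op}}$ are majority categories, then $\mathbb{C}$ is a preorder (i.e. for any two objects $S,A$ of $\mathbb{C}$ there is at most one morphism $S\to A$).
   Context: A ternary relation between objects $A,B,C$ of a category is a quadruple $R=(R_0,r_1,r_2,r_3)$ where $r_1:R_0\to A$, $r_2:R_0\to B$, $r_3:R_0\to C$ are jointly monomorphic. For morphisms $a:S\to A$, $b:S\to B$, $c:S\to C$, the triple $(a,b,c)$ is $R$-related if there is a morphism $f:S\to R_0$ with $r_1f=a$, $r_2f=b$, $r_3f=c$. A category is a majority category if for any ternary relation $R$ between any objects $A,B,C$ and any morphisms $a_1,a_2:S\to A$, $b_1,b_2:S\to B$, $c_1,c_2:S\to C$: if $(a_1,b_1,c_2)$, $(a_1,b_2,c_1)$ and $(a_2,b_1,c_1)$ are $R$-related, then $(a_1,b_1,c_1)$ is $R$-related. *)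

(* Defs.v *)
From Stdlib Require Import List FinFun.

Set Implicit Arguments.
Unset Strict Implicit.
Unset Printing Implicit Defensive.

Declare Scope cat_scope.
Delimit Scope cat_scope with cat.

(* Morphisms between two fixed objects form a type whose Leibniz equality is
   equality of morphisms; objects may be large. *)
Record category := Category {
  obj :> Type;
  hom : obj -> obj -> Type;
  idm : forall x, hom x x;
  comp : forall x y z, hom y z -> hom x y -> hom x z;
  comp_idl : forall x y (f : hom x y), comp (idm y) f = f;
  comp_idr : forall x y (f : hom x y), comp f (idm x) = f;
  comp_assoc : forall w x y z (h : hom y z) (g : hom x y) (f : hom w x),
    comp h (comp g f) = comp (comp h g) f }.

Arguments hom {c} x y.
Arguments idm {c} x.
Arguments comp {c x y z} g f.

Notation "g ∘ f" := (comp g f) (at level 40, left associativity) : cat_scope.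
Local Open Scope cat_scope.

Definition opposite (C : category) : category :=
  @Category C (fun x y => @hom C y x) (fun x => idm x)
    (fun x y z g f => f ∘ g)
    (fun x y f => comp_idr f) (fun x y f => comp_idl f)
    (fun w x y z h g f => eq_sym (comp_assoc f g h)).

Record functor (J C : category) := Functor {
  fobj :> J -> C;
  fmap : forall i j, hom i j -> hom (fobj i) (fobj j);
  fmap_id : forall i, fmap (idm i) = idm (fobj i);
  fmap_comp : forall i j k (v : hom j k) (u : hom i j),
    fmap (v ∘ u) = fmap v ∘ fmap u }.

Arguments fmap {J C} f {i j} u.

Record cone (J C : category) (F : functor J C) := Cone {
  apex : C;
  leg : forall j, hom apex (F j);
  leg_natural : forall i j (u : hom i j), fmap F u ∘ leg i = leg j }.

Definition is_limit (J C : category) (F : functor J C) (L : cone F) : Prop :=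
  forall K : cone F, exists! h : hom (apex K) (apex L),
    forall j, leg L j ∘ h = leg K j.

Definition finite_category (J : category) : Prop :=
  Finite J /\ forall i j : J, Finite (hom i j).

Definition has_finite_limits (C : category) : Prop :=
  forall J : category, finite_category J ->
  forall F : functor J C, exists L : cone F, is_limit L.

Definition is_coproduct (C : category) (A B P : C)
    (i1 : hom A P) (i2 : hom B P) : Prop :=
  forall (X : C) (f : hom A X) (g : hom B X),
  exists! h : hom P X, h ∘ i1 = f /\ h ∘ i2 = g.

Definition has_binary_coproducts (C : category) : Prop :=
  forall A B : C, exists (P : C) (i1 : hom A P) (i2 : hom B P),
    is_coproduct i1 i2.

Definition jointly_monic (C : category) (R A1 A2 A3 : C)
    (r1 : hom R A1) (r2 : hom R A2) (r3 : hom R A3) : Prop :=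
  forall (S : C) (f g : hom S R),
    r1 ∘ f = r1 ∘ g -> r2 ∘ f = r2 ∘ g -> r3 ∘ f = r3 ∘ g -> f = g.

Record ternary_relation (C : category) (A1 A2 A3 : C) := TernaryRelation {
  rel_obj : C;
  rel1 : hom rel_obj A1;
  rel2 : hom rel_obj A2;
  rel3 : hom rel_obj A3;
  rel_monic : jointly_monic rel1 rel2 rel3 }.

Definition related (C : category) (A1 A2 A3 : C)
    (R : ternary_relation A1 A2 A3) (S : C)
    (a : hom S A1) (b : hom S A2) (c : hom S A3) : Prop :=
  exists f : hom S (rel_obj R),
    rel1 R ∘ f = a /\ rel2 R ∘ f = b /\ rel3 R ∘ f = c.

Definition majority_category (C : category) : Prop :=
  forall (A1 A2 A3 : C) (R : ternary_relation A1 A2 A3) (S : C)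
    (a1 a2 : hom S A1) (b1 b2 : hom S A2) (c1 c2 : hom S A3),
    related R a1 b1 c2 -> related R a1 b2 c1 -> related R a2 b1 c1 ->
    related R a1 b1 c1.

Definition is_preorder (C : category) : Prop :=
  forall (S A : C) (f g : hom S A), f = g.

(* Main.v *)
Require Import Defs.
From Stdlib Require Import List FinFun Bool Eqdep_dec.

(** Morphisms [S -> X] are treated as elements of [X] at stage [S].

    Majority in [C] makes [X³] small as seen from below: the subobject of [X³]
    on which two morphisms [u], [v] agree is a ternary relation, and an
    arbitrary triple [(x, y, z)] is the majority of [(x, y, x)], [(x, x, z)]
    and [(y, y, z)].  So [u = v] as soon as they agree on triples with a
    repeated entry ([agree_on_degenerate_triples]); in other words the three
    maps [X² -> X³] with values [(x, x, y)], [(x, y, x)], [(y, x, x)] are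
    jointly epic, and form a ternary relation in the dual category.

    Majority in the dual category, applied to this relation and to the three
    projections of [X³], extends the first projection of [X²] along all three
    maps at once.  The result is a majority operation [m : X³ -> X]
    ([majority_operation_exists]).

    Majority in [C], applied to the graph of [m] split so that two components
    share the first argument, forces [m (x, y, z) = x], because
    [m (x, y, x) = x = m (x, x, z)] ([majority_operation_is_projection]).  But
    [m (x, y, y) = y], so any two elements of [X] at the same stage coincide. *)

Set Implicit Arguments.
Unset Strict Implicit.
Unset Printing Implicit Defensive.

Local Open Scope cat_scope.

(** * Products and equalizers from finite limits *)

Definition is_product (C : category) (A B P : C)
    (p1 : hom P A) (p2 : hom P B) : Prop :=
  forall (S : C) (a : hom S A) (b : hom S B),
  exists! h : hom S P, p1 ∘ h = a /\ p2 ∘ h = b.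

Definition is_ternary_product (C : category) (A1 A2 A3 P : C)
    (p1 : hom P A1) (p2 : hom P A2) (p3 : hom P A3) : Prop :=
  (forall (S : C) (a1 : hom S A1) (a2 : hom S A2) (a3 : hom S A3),
    exists h : hom S P, p1 ∘ h = a1 /\ p2 ∘ h = a2 /\ p3 ∘ h = a3) /\
  jointly_monic p1 p2 p3.

Definition is_equalizer (C : category) (A B E : C)
    (u v : hom A B) (e : hom E A) : Prop :=
  u ∘ e = v ∘ e /\
  forall (S : C) (h : hom S A), u ∘ h = v ∘ h -> exists! k : hom S E, e ∘ k = h.

Definition discrete_bool : category :=
  @Category bool (fun i j => i = j) (fun i => eq_refl)
    (fun i j k q p => eq_trans p q)
    (fun i j f => match f with eq_refl => eq_refl end)
    (fun i j f => match f with eq_refl => eq_refl end)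
    (fun i j k l h g f =>
      match h with eq_refl => match g with eq_refl => eq_refl end end).

Lemma bool_finite : Finite bool.
Proof. exists (true :: false :: nil). intros [|]; simpl; tauto. Qed.

Lemma discrete_bool_finite : finite_category discrete_bool.
Proof.
  split; [exact bool_finite|].
  intros i j. destruct (bool_dec i j) as [e|n].
  - exists (e :: nil). intros e'. left. apply (UIP_dec bool_dec).
  - exists nil. intros e. destruct (n e).
Qed.

Definition pair_functor (C : category) (A B : C) : functor discrete_bool C.
Proof.
  refine (@Functor discrete_bool C (fun i : bool => if i then A else B)
    (fun i j p => match p in _ = j
       return hom (if i then A else B) (if j then A else B)
       with eq_refl => idm _ end) _ _).
  - reflexivity.
  - intros i j k q p. destruct q, p. simpl. symmetry. apply comp_idl.
Defined.

Definition pair_cone (C : category) (A B S : C) (a : hom S A) (b : hom S B) :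
  cone (pair_functor A B).
Proof.
  refine (@Cone discrete_bool C (pair_functor A B) S
    (fun i : bool =>
       if i return hom S (if i then A else B) then a else b) _).
  intros i j u. destruct u. apply comp_idl.
Defined.

Lemma binary_products (C : category) :
  has_finite_limits C ->
  forall A B : C, exists (P : C) (p1 : hom P A) (p2 : hom P B),
    is_product p1 p2.
Proof.
  intros lim A B.
  destruct (lim _ discrete_bool_finite (pair_functor A B)) as [L HL].
  exists (apex L), (leg L true), (leg L false).
  intros S a b. destruct (HL (pair_cone a b)) as [h [Hh Huniq]].
  exists h. split.
  - split; [exact (Hh true)|exact (Hh false)].
  - intros k [Ha Hb]. apply Huniq. intros [|]; assumption.
Qed.

Lemma product_ext (C : category) (A B P : C) (p1 : hom P A) (p2 : hom P B) :
  is_product p1 p2 ->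
  forall (S : C) (h k : hom S P), p1 ∘ h = p1 ∘ k -> p2 ∘ h = p2 ∘ k -> h = k.
Proof.
  intros HP S h k E1 E2.
  destruct (HP S (p1 ∘ k) (p2 ∘ k)) as [l [_ Huniq]].
  rewrite <- (Huniq h (conj E1 E2)). apply Huniq. split; reflexivity.
Qed.

Lemma ternary_products (C : category) :
  has_finite_limits C ->
  forall A1 A2 A3 : C, exists (P : C) (p1 : hom P A1) (p2 : hom P A2)
    (p3 : hom P A3), is_ternary_product p1 p2 p3.
Proof.
  intros lim A1 A2 A3.
  destruct (binary_products lim A1 A2) as [Q [q1 [q2 HQ]]].
  destruct (binary_products lim Q A3) as [P [r1 [r2 HP]]].
  exists P, (q1 ∘ r1), (q2 ∘ r1), r2. split.
  - intros S a1 a2 a3.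
    destruct (HQ S a1 a2) as [h [[H1 H2] _]].
    destruct (HP S h a3) as [k [[H H3] _]].
    exists k. rewrite <- !comp_assoc, H. auto.
  - intros S f g E1 E2 E3. rewrite <- !comp_assoc in E1, E2.
    apply (product_ext HP); [|assumption].
    apply (product_ext HQ); assumption.
Qed.

(** The walking parallel pair: [false] is the source, [true] the target and
    the two arrows between them are the two booleans. *)
Definition parallel_hom (i j : bool) : Type :=
  match i, j with
  | false, true => bool
  | true, false => Empty_set
  | _, _ => unit
  end.

Definition parallel_pair : category.
Proof.
  refine (@Category bool parallel_hom
    (fun i => if i return parallel_hom i i then tt else tt)
    (fun i j k => match i, j, k
       return parallel_hom j k -> parallel_hom i j -> parallel_hom i k with
       | false, false, true => fun g _ => g
       | false, true, true => fun _ f => f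
       | true, false, _ => fun _ f => match f with end
       | _, true, false => fun g _ => match g with end
       | true, true, true => fun _ _ => tt
       | false, false, false => fun _ _ => tt
       end) _ _ _).
  - intros [|] [|]; simpl; try (intros []; reflexivity).
  - intros [|] [|]; simpl; try (intros []; reflexivity).
  - intros [|] [|] [|] [|]; simpl; intros; try reflexivity;
      match goal with x : Empty_set |- _ => destruct x end.
Defined.

Lemma parallel_pair_finite : finite_category parallel_pair.
Proof.
  split; [exact bool_finite|].
  assert (Hunit : Finite unit).
  { exists (tt :: nil). intros []. simpl. tauto. }
  intros [|] [|]; simpl; try assumption.
  - exists nil. intros [].
  - exact bool_finite.
Qed.

Definition parallel_functor (C : category) (A B : C) (u v : hom A B) :
  functor parallel_pair C.
Proof.
  refine (@Functor parallel_pair C (fun i : bool => if i then B else A)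
    (fun i j => match i, j return
       parallel_hom i j -> hom (if i then B else A) (if j then B else A) with
       | false, true => fun s : bool => if s then u else v
       | true, false => fun s => match s with end
       | true, true => fun _ => idm B
       | false, false => fun _ => idm A
       end) _ _).
  - intros [|]; reflexivity.
  - intros [|] [|] [|] g f; simpl in *;
      try (match goal with x : Empty_set |- _ => destruct x end);
      symmetry; first [apply comp_idl | apply comp_idr].
Defined.

Definition fork_cone (C : category) (A B S : C) (u v : hom A B) (h : hom S A)
    (E : u ∘ h = v ∘ h) : cone (parallel_functor u v).
Proof.
  refine (@Cone parallel_pair C (parallel_functor u v) S
    (fun i : bool =>
       if i return hom S (if i then B else A) then u ∘ h else h) _).
  intros [|] [|] s; simpl in *.
  - apply comp_idl.
  - destruct s.
  - destruct s; [reflexivity|symmetry; exact E].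
  - apply comp_idl.
Defined.

Lemma equalizers (C : category) :
  has_finite_limits C ->
  forall (A B : C) (u v : hom A B), exists (E : C) (e : hom E A),
    is_equalizer u v e.
Proof.
  intros lim A B u v.
  destruct (lim _ parallel_pair_finite (parallel_functor u v)) as [L HL].
  pose proof (leg_natural L (true : @hom parallel_pair false true)) as Hu.
  pose proof (leg_natural L (false : @hom parallel_pair false true)) as Hv.
  simpl in Hu, Hv.
  exists (apex L), (leg L false). split.
  - exact (eq_trans Hu (eq_sym Hv)).
  - intros S h E. destruct (HL (fork_cone E)) as [k [Hk Huniq]].
    exists k. split; [exact (Hk false)|].
    intros l Hl. apply Huniq. intros [|]; [|exact Hl]. simpl.
    (* The leg at the target is determined by the leg at the source. *)
    transitivity ((u ∘ leg L false) ∘ l).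
    + rewrite Hu. reflexivity.
    + rewrite <- comp_assoc. f_equal. exact Hl.
Qed.

Lemma equalizer_mono (C : category) (A B E : C) (u v : hom A B) (e : hom E A) :
  is_equalizer u v e ->
  forall (S : C) (f g : hom S E), e ∘ f = e ∘ g -> f = g.
Proof.
  intros [He Huniv] S f g Efg.
  destruct (Huniv S (e ∘ g)) as [k [_ Huniq]].
  { rewrite !comp_assoc, He. reflexivity. }
  rewrite <- (Huniq f Efg). apply Huniq. reflexivity.
Qed.

(** * The majority operation and its collapse *)

(** The equalizer of [u] and [v] is a ternary relation on [X], and the generic
    triple [(x, y, z)] is the majority of [(x, y, x)], [(x, x, z)] and
    [(y, y, z)], which have a repeated entry. *)
Lemma agree_on_degenerate_triples (C : category)
    (lim : has_finite_limits C) (maj : majority_category C)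
    (X P : C) (p1 p2 p3 : hom P X) (HP : is_ternary_product p1 p2 p3)
    (Y : C) (u v : hom P Y) :
  (forall (S : C) (h : hom S P), p1 ∘ h = p2 ∘ h -> u ∘ h = v ∘ h) ->
  (forall (S : C) (h : hom S P), p1 ∘ h = p3 ∘ h -> u ∘ h = v ∘ h) ->
  u = v.
Proof.
  intros H12 H13. destruct HP as [Htuple Hmono].
  destruct (equalizers lim u v) as [E [e HE]].
  assert (Rmono : jointly_monic (p1 ∘ e) (p2 ∘ e) (p3 ∘ e)).
  { intros S f g E1 E2 E3. rewrite <- !comp_assoc in E1, E2, E3.
    apply (equalizer_mono HE). apply Hmono; assumption. }
  set (R := TernaryRelation Rmono).
  assert (Rrelated : forall (S : C) (h : hom S P), u ∘ h = v ∘ h ->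
    related R (p1 ∘ h) (p2 ∘ h) (p3 ∘ h)).
  { intros S h Eh. destruct (proj2 HE S h Eh) as [k [Hk _]].
    exists k. simpl. rewrite <- !comp_assoc, Hk. auto. }
  destruct (Htuple P p1 p2 p1) as [h1 [E11 [E12 E13]]].
  destruct (Htuple P p1 p1 p3) as [h2 [E21 [E22 E23]]].
  destruct (Htuple P p2 p2 p3) as [h3 [E31 [E32 E33]]].
  assert (R1 := Rrelated _ h1 (H13 _ h1 (eq_trans E11 (eq_sym E13)))).
  assert (R2 := Rrelated _ h2 (H12 _ h2 (eq_trans E21 (eq_sym E22)))).
  assert (R3 := Rrelated _ h3 (H12 _ h3 (eq_trans E31 (eq_sym E32)))).
  rewrite E11, E12, E13 in R1. rewrite E21, E22, E23 in R2.
  rewrite E31, E32, E33 in R3.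
  destruct (maj _ _ _ R _ _ _ _ _ _ _ R1 R2 R3) as [s [S1 [S2 S3]]].
  simpl in s, S1, S2, S3.
  (* The generic triple is the identity of [P], so [e] has a section. *)
  assert (Hs : e ∘ s = idm P).
  { apply Hmono; rewrite comp_assoc, comp_idr; assumption. }
  rewrite <- (comp_idr u), <- (comp_idr v), <- Hs, !comp_assoc.
  rewrite (proj1 HE). reflexivity.
Qed.

Definition majority_operation (C : category) (X P : C) (p1 p2 p3 m : hom P X) :
    Prop :=
  forall (S : C) (h : hom S P),
    (p1 ∘ h = p2 ∘ h -> m ∘ h = p1 ∘ h) /\
    (p1 ∘ h = p3 ∘ h -> m ∘ h = p1 ∘ h) /\
    (p2 ∘ h = p3 ∘ h -> m ∘ h = p2 ∘ h).

(** The maps [(x, x, y)], [(x, y, x)], [(y, x, x)] from [X²] to [X³] are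
    jointly epic, so they are a ternary relation in the dual category.  Triples
    of morphisms [X² -> X] related by it are those that extend to [X³]; the
    projections of [X³] show that [(x, x, y)], [(x, y, x)] and [(y, x, x)]
    extend, hence so does [(x, x, x)], and the extension is the operation. *)
Lemma majority_operation_exists (C : category)
    (lim : has_finite_limits C) (maj : majority_category C)
    (maj_op : majority_category (opposite C))
    (X P : C) (p1 p2 p3 : hom P X) (HP : is_ternary_product p1 p2 p3) :
  exists m : hom P X, majority_operation p1 p2 p3 m.
Proof.
  destruct (binary_products lim X X) as [Q [x [y HQ]]].
  assert (Htuple := proj1 HP). assert (Hmono := proj2 HP).
  destruct (Htuple Q x x y) as [q1 [E11 [E12 E13]]].
  destruct (Htuple Q x y x) as [q2 [E21 [E22 E23]]].
  destruct (Htuple Q y x x) as [q3 [E31 [E32 E33]]].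
  (* Every triple with a repeated entry factors through one of these maps. *)
  assert (F1 : forall (S : C) (h : hom S P), p1 ∘ h = p2 ∘ h ->
    exists k : hom S Q, q1 ∘ k = h /\ x ∘ k = p1 ∘ h).
  { intros S h Eh. destruct (HQ S (p1 ∘ h) (p3 ∘ h)) as [k [[Kx Ky] _]].
    exists k. split; [|exact Kx].
    apply Hmono; rewrite comp_assoc, ?E11, ?E12, ?E13; congruence. }
  assert (F2 : forall (S : C) (h : hom S P), p1 ∘ h = p3 ∘ h ->
    exists k : hom S Q, q2 ∘ k = h /\ x ∘ k = p1 ∘ h).
  { intros S h Eh. destruct (HQ S (p1 ∘ h) (p2 ∘ h)) as [k [[Kx Ky] _]].
    exists k. split; [|exact Kx].
    apply Hmono; rewrite comp_assoc, ?E21, ?E22, ?E23; congruence. }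
  assert (F3 : forall (S : C) (h : hom S P), p2 ∘ h = p3 ∘ h ->
    exists k : hom S Q, q3 ∘ k = h /\ x ∘ k = p2 ∘ h).
  { intros S h Eh. destruct (HQ S (p2 ∘ h) (p1 ∘ h)) as [k [[Kx Ky] _]].
    exists k. split; [|exact Kx].
    apply Hmono; rewrite comp_assoc, ?E31, ?E32, ?E33; congruence. }
  assert (Repi : @jointly_monic (opposite C) P Q Q Q q1 q2 q3).
  { intros Y u v G1 G2 _. simpl in u, v, G1, G2.
    apply (agree_on_degenerate_triples lim maj HP); intros S h Eh.
    - destruct (F1 S h Eh) as [k [<- _]]. rewrite !comp_assoc, G1. reflexivity.
    - destruct (F2 S h Eh) as [k [<- _]]. rewrite !comp_assoc, G2. reflexivity. }
  destruct (maj_op Q Q Q (TernaryRelation Repi) X x y x y x y) as [m [M1 [M2 M3]]].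
  { exists p1. auto. }
  { exists p2. auto. }
  { exists p3. auto. }
  simpl in m, M1, M2, M3. exists m. intros S h. split; [|split]; intros Eh.
  - destruct (F1 S h Eh) as [k [Hk <-]]. rewrite <- Hk, comp_assoc, M1. reflexivity.
  - destruct (F2 S h Eh) as [k [Hk <-]]. rewrite <- Hk, comp_assoc, M2. reflexivity.
  - destruct (F3 S h Eh) as [k [Hk <-]]. rewrite <- Hk, comp_assoc, M3. reflexivity.
Qed.

(** The triples [((x, y), (x, z), m (x, y, z))] form a ternary relation between
    [X²], [X²] and [X].  It contains [((x, y), (x, x), x)] and
    [((x, x), (x, z), x)], and [((x, y), (x, z))] occurs in it with some third
    entry; by majority this entry must be [x]. *)
Lemma majority_operation_is_projection (C : category)
    (lim : has_finite_limits C) (maj : majority_category C)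
    (X P : C) (p1 p2 p3 : hom P X) (HP : is_ternary_product p1 p2 p3)
    (m : hom P X) :
  majority_operation p1 p2 p3 m -> m = p1.
Proof.
  intros Hm. destruct (binary_products lim X X) as [Q [x [y HQ]]].
  destruct HP as [Htuple Hmono].
  destruct (HQ P p1 p2) as [l [[L1 L2] _]].
  destruct (HQ P p1 p3) as [r [[R1 R2] _]].
  destruct (HQ P p1 p1) as [d [[D1 D2] _]].
  assert (lr_monic : forall (S : C) (f g : hom S P),
    l ∘ f = l ∘ g -> r ∘ f = r ∘ g -> f = g).
  { intros S f g El Er. apply Hmono.
    - rewrite <- L1, <- !comp_assoc, El. reflexivity.
    - rewrite <- L2, <- !comp_assoc, El. reflexivity.
    - rewrite <- R2, <- !comp_assoc, Er. reflexivity. }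
  assert (Rmono : jointly_monic l r m) by (intros S f g El Er _; auto).
  destruct (maj _ _ _ (TernaryRelation Rmono) P l d r d p1 m)
    as [k [Kl [Kr Km]]].
  - exists (idm P). simpl. rewrite !comp_idr. auto.
  - destruct (Htuple P p1 p2 p1) as [h [H1 [H2 H3]]]. exists h. simpl.
    split; [|split].
    + apply (product_ext HQ); rewrite comp_assoc, ?L1, ?L2; congruence.
    + apply (product_ext HQ); rewrite comp_assoc, ?R1, ?R2; congruence.
    + destruct (Hm P h) as [_ [M _]]. rewrite M; congruence.
  - destruct (Htuple P p1 p1 p3) as [h [H1 [H2 H3]]]. exists h. simpl.
    split; [|split].
    + apply (product_ext HQ); rewrite comp_assoc, ?L1, ?L2; congruence.
    + apply (product_ext HQ); rewrite comp_assoc, ?R1, ?R2; congruence.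
    + destruct (Hm P h) as [M _]. rewrite M; congruence.
  - simpl in k, Kl, Kr, Km.
    assert (Hk : k = idm P) by (apply lr_monic; rewrite comp_idr; assumption).
    rewrite Hk, comp_idr in Km. exact Km.
Qed.

Theorem theorem5 (C : category)
    (finlim : has_finite_limits C)
    (coprod : has_binary_coproducts C)
    (maj : majority_category C)
    (maj_op : majority_category (opposite C)) :
  is_preorder C.
Proof.
  intros S X f g.
  destruct (ternary_products finlim X X X) as [P [p1 [p2 [p3 HP]]]].
  destruct (majority_operation_exists finlim maj maj_op HP) as [m Hm].
  assert (Hproj := majority_operation_is_projection finlim maj HP Hm).
  (* Both [f] and [g] are the value of [m] at [(f, g, g)]. *)
  destruct (proj1 HP S f g g) as [h [H1 [H2 H3]]].
  destruct (Hm S h) as [_ [_ M]].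
  rewrite <- H1, <- H2, <- Hproj. apply M. congruence.
Qed.
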